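(* Let $G$ be a countable discrete amenable group, $X=\mathbb{N}^G$, and let $\phi\colon X\to\mathbb{R}$ be an exp-summable potential with summable variation according to an exhausting sequence $\{E_m\}_m$ of $G$. Then a Borel probability measure $\mu$ on $X$ is a DLR measure for $\phi$ if and only if $\mu$ is a conformal measure for $\phi$.
   Context: $\mathbb{N}$ is the set of non-negative integers; $\mathcal{F}(S)$ is the set of nonempty finite subsets of a set $S$. $X=\mathbb{N}^G$ has the product topology and Borel $\sigma$-algebra $\mathcal{B}$; for $D\subseteq G$, $\mathcal{B}_D$ is the $\sigma$-algebra generated by the coordinates in $D$. $x_D$ denotes the restriction of $x$ to $D$; for $w\in\mathbb{N}^K$, $[w]=\{x: x_K=w\}$ and $w x_{K^c}$ is the configuration equal to $w$ on $K$ and to $x$ on $K^c=G\setminus K$. $G$ acts by $(g\cdot x)(h)=x(hg)$; $\phi_F(x)=\sum_{g\in F}\phi(g\cdot x)$ for $F\in\mathcal F(G)$. An exhausting sequence is a sequence $\{E_m\}_{m\ge0}$ of finite subsets of $G$ with $E_0=\emptyset$, $E_1=\{1_G\}$, strictly increasing, with $\bigcup_mE_m=G$. With $\delta_E(\phi)=\sup\{|\phi(x)-\phi(y)|:x_E=y_E\}$, $\phi$ has summable variation according to $\{E_m\}_m$ if $V(\phi)=\sum_{m\ge1}|E_{m+1}^{-1}\setminus E_m^{-1}|\,\delta_{E_m}(\phi)<\infty$. $\phi$ is exp-summable if $\sum_{a\in\mathbb{N}}\exp(\sup\{\phi(x):x(1_G)=a\})<\infty$. DLR measure: for $K\in\mathcal{F}(G)$,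 $B\in\mathcal{B}$, $x\in X$ let $$\gamma_K(B,x)=\lim_{m\to\infty}\frac{\sum_{w\in\mathbb{N}^K}\exp(\phi_{E_m}(wx_{K^c}))\mathbf{1}_{\{wx_{K^c}\in B\}}}{\sum_{v\in\mathbb{N}^K}\exp(\phi_{E_m}(vx_{K^c}))}$$ (the limit exists under the present hypotheses). A Borel probability measure $\mu$ is a DLR measure for $\phi$ if $\mu(B\,|\,\mathcal{B}_{K^c})(x)=\gamma_K(B,x)$ for $\mu$-a.e. $x$, for every $K\in\mathcal{F}(G)$ and $B\in\mathcal{B}$. Conformal measure: for $K\in\mathcal{F}(G)$ and $A\in\mathcal{F}(\mathbb{N})$, $\mathcal{E}_{K,A}$ is the set of maps $\tau\colon X\to X$ of the form $\tau(x)_g=\tau_g(x_g)$ for $g\in K$ and $\tau(x)_g=x_g$ for $g\notin K$, where each $\tau_g$ is a permutation of $\mathbb{N}$ fixing every element of $\mathbb{N}\setminus A$. For such $\tau$, $\phi_*^\tau=\lim_{m\to\infty}(\phi_{E_m}\circ\tau^{-1}-\phi_{E_m})$ (a uniform limit that exists under the present hypotheses). A Borel probability measure $\mu$ is conformal for $\phi$ if $\frac{d(\mu\circ\tau^{-1})}{d\mu}=\exp(\phi_*^\tau)$ $\mu$-a.s. for every $A\in\mathcal{F}(\mathbb{N})$, $K\in\mathcal{F}(G)$ and $\tau\in\mathcal{E}_{K,A}$. *)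

(* Defs.v *)
From HB Require Import structures.
From mathcomp Require Import all_boot all_order all_algebra finmap.
From mathcomp Require Import all_classical all_reals all_analysis.

Set Implicit Arguments.
Unset Strict Implicit.
Unset Printing Implicit Defensive.

Import Order.TTheory GRing.Theory Num.Theory.
Import numFieldNormedType.Exports.

Local Open Scope classical_set_scope.
Local Open Scope ring_scope.

(* The Følner condition: every pair (K, eps) admits a (K, eps)-invariant set. *)
Definition amenable (R : realType) (G : groupType) : Prop :=
  forall (K : {fset G}) (eps : R), K != fset0%fset -> 0 < eps ->
  exists2 F : {fset G}, F != fset0%fset &
    let KF := [fset (k * f)%g | k in K, f in F]%fset in
    #|` (KF `\` F) `|` (F `\` KF)|%fset%:R < eps * #|` F|%:R.

Definition exhausting (G : groupType) (E : nat -> {fset G}) : Prop :=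
  [/\ E 0%N = fset0%fset, E 1%N = [fset 1%g]%fset,
      (forall m, (E m `<` E m.+1)%fset) &
      (forall g, exists m, g \in E m)].

Definition fset_inv (G : groupType) (F : {fset G}) : {fset G} :=
  [fset (g^-1)%g | g in F]%fset.

(* X = nat^G; its measurable sets are the Borel sets of the product of the
   discrete topologies. *)
Notation config G := (g_sigma_algebraType (@open {ptws G -> nat})).

Section Potentials.
Context (R : realType) (G : groupType).
Implicit Types (phi : config G -> R) (E : nat -> {fset G}) (K F : {fset G}).

Definition shift (g : G) (x : config G) : config G := fun h => x (h * g)%g.

Definition birkhoff phi F (x : config G) : R :=
  \sum_(g <- F) phi (shift g x).

Definition variation phi F : \bar R :=
  ereal_sup [set r | exists x y : config G,
    (forall g, g \in F -> x g = y g) /\ r = (`|phi x - phi y|)%:E].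

Definition summable_variation E phi : Prop :=
  (\sum_(1 <= m <oo)
     (#|` fset_inv (E m.+1) `\` fset_inv (E m)|%fset%:R%:E * variation phi (E m))
   < +oo)%E.

Definition exp_summable phi : Prop :=
  (\sum_(0 <= a <oo)
     expeR (ereal_sup [set (phi x)%:E | x in [set x : config G | x 1%g = a]])
   < +oo)%E.

(* [splice w x] is w on K and x off K. *)
Definition splice K (w : {ffun K -> nat}) (x : config G) : config G :=
  fun g => oapp w (x g) (insub g).

(* For small m (K not included in E m) both sums may be infinite, in which case
   [fine] makes this term 0; this does not affect the limit in [gibbs_kernel]. *)
Definition finite_gibbs_kernel E phi K (B : set (config G)) (x : config G)
    (m : nat) : R :=
  fine (\esum_(w in [set: {ffun K -> nat}])
          (expR (birkhoff phi (E m) (splice w x)) * \1_B (splice w x))%:E) /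
  fine (\esum_(v in [set: {ffun K -> nat}])
          (expR (birkhoff phi (E m) (splice v x)))%:E).

Definition gibbs_kernel E phi K (B : set (config G)) (x : config G) : R :=
  limn (finite_gibbs_kernel E phi K B x).

Definition coord_sigma (D : set G) : set (set (config G)) :=
  <<s [set C | exists2 g, D g & exists V : set nat,
         C = [set x : config G | V (x g)]] >>.

(* f is a version of mu(B | S). *)
Definition is_cond_prob (mu : probability (config G) R)
    (S : set (set (config G))) (B : set (config G)) (f : config G -> R) : Prop :=
  [/\ (forall V : set R, measurable V -> S (f @^-1` V)),
      mu.-integrable setT (EFin \o f) &
      (forall A, S A -> (\int[mu]_(x in A) (f x)%:E = mu (A `&` B))%E)].

Definition is_DLR E phi (mu : probability (config G) R) : Prop :=
  forall K, K != fset0%fset -> forall B : set (config G), measurable B ->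
  exists2 f : config G -> R,
    is_cond_prob mu (coord_sigma (~` [set` K])) B f &
    {ae mu, forall x, f x = gibbs_kernel E phi K B x}.

Definition local_perm K (A : {fset nat}) (tau : config G -> config G) : Prop :=
  exists t : G -> nat -> nat,
    [/\ (forall g, bijective (t g)),
        (forall g a, a \notin A -> t g a = a) &
        (forall x g, tau x g = if g \in K then t g (x g) else x g)].

(* [cocycle E phi taui] is phi_*^tau, where taui is the inverse of tau. *)
Definition cocycle E phi (taui : config G -> config G) (x : config G) : R :=
  limn (fun m => birkhoff phi (E m) (taui x) - birkhoff phi (E m) x).

(* The restriction to measurable maps tau, which [distribution] needs, loses
   nothing: see [local_perm_measurable]. [local_perm_bijective] shows that taui
   always exists. *)
Definition is_conformal E phi (mu : probability (config G) R) : Prop :=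
  forall K (A : {fset nat}), K != fset0%fset -> A != fset0%fset ->
  forall (tau : {mfun config G >-> config G}) (taui : config G -> config G),
    local_perm K A tau -> cancel tau taui -> cancel taui tau ->
    {ae mu, forall x,
      Radon_Nikodym (charge_of_finite_measure (distribution mu tau)) mu x =
      (expR (cocycle E phi taui x))%:E}.

End Potentials.

Section LocalPerm.
Context (G : groupType) (K : {fset G}) (A : {fset nat}).
Variable tau : config G -> config G.
Hypothesis tauP : local_perm K A tau.

Lemma local_perm_bijective : bijective tau.
Proof.
have [t [tbij _ tE]] := tauP.
have /choice[s sP] : forall g, exists s, cancel (t g) s /\ cancel s (t g).
  by move=> g; have [s ts st] := tbij g; exists s.
exists (fun x g => if g \in K then s g (x g) else x g) => x;
  apply/funext => g; rewrite ?tE; case: ifPn => // gK;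
  rewrite ?tE ?gK ?(negPf gK) //; [exact: (sP g).1 | exact: (sP g).2].
Qed.

Lemma local_perm_measurable : measurable_fun setT tau.
Proof.
have [t [_ _ tE]] := tauP.
have tauc : continuous (tau : {ptws G -> nat} -> {ptws G -> nat}).
  move=> x; apply/cvg_sup => g U [/= _ [[W oW <-]] /= Wx] /filterS; apply.
  pose u (a : nat) := if g \in K then t g a else a.
  have uW : nbhs (proj g x) (u @^-1` W).
    by rewrite nbhs_principalE; apply/principal_filterP; rewrite /u /= -tE.
  have uWx : nbhs (x : {ptws G -> nat}) (proj g @^-1` (u @^-1` W)).
    exact: (@proj_continuous G (fun=> nat) g x).
  by congr (nbhs _ _) : uWx; apply/funext => y /=; rewrite tE.
apply: (@measurability _ _ (config G) (config G) setT tau (@open {ptws G -> nat})) => //.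
move=> _ [B oB <-]; rewrite setTI; apply: sub_sigma_algebra.
by move/continuousP : tauc; apply.
Qed.

End LocalPerm.

(* Main.v *)
Require Import Defs.
From HB Require Import structures.
From mathcomp Require Import all_boot all_order all_algebra finmap.
From mathcomp Require Import all_classical all_reals all_analysis.
From mathcomp Require Import measurable_realfun ring lra.

Set Implicit Arguments.
Unset Strict Implicit.
Unset Printing Implicit Defensive.

Import Order.TTheory GRing.Theory Num.Theory.
Import numFieldNormedType.Exports.

Local Open Scope classical_set_scope.
Local Open Scope ring_scope.

(** Fix a nonempty finite [K] and enumerate the patterns on [K] as [e n]. Their cylinders [C n]
    partition the space, and [S n], which writes [e n] on [K], retracts the space onto [C n].
    Summable variation makes the differences of Birkhoff sums at x and y converge, uniformly over
    pairs that agree off [K] ([energy_seq_cauchy], [energy_approx]); exp-summability makes the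
    resulting weights of the patterns summable ([weight_summable]). So the limit kernel is an
    explicit average: gamma_K(B, x) is the sum over n of p_n(x) 1_B(S_n x), where the p_n are
    positive, sum to 1 and depend on x off [K] only ([gibbs_kernelE]).

    The DLR condition for [K] amounts to [specification_eq], by which p_n is the conditional
    probability of [C n] given the outside ([DLR_specification]). Conformality for [K] amounts to
    [conformal_eq], by which moving mass from [C n] to [C m] has density p_n / p_m
    ([conformal_volume]). Indeed a local permutation is a splice map on each cylinder, any two
    cylinders are exchanged by such a permutation, and on [C m] the ratio p_n / p_m is the
    exponential of the energy difference between S_n x and x ([p_ratio]).

    These two equations are equivalent by measure theory alone. Under the specification, functions
    of the outside integrate alike against 1_(C m) and p_m, which yields the densities p_n / p_m;
    conversely, inserting the sum of the p_m, which is 1, and moving mass cell by cell recovers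
    p_n. *)

Lemma measurable_fun_inv_gt0 d (T : measurableType d) (R : realType) (f : T -> R) :
  measurable_fun setT f -> (forall x, 0 < f x) ->
  measurable_fun setT (fun x => (f x)^-1).
Proof.
move=> mf f0; apply: (eq_measurable_fun (fun x => expR (- ln (f x)))) => [x _|].
  by rewrite expRN lnK// posrE.
apply: measurableT_comp => //; apply: measurableT_comp => //.
by apply: measurableT_comp.
Qed.

                                                                       

(** * Integrals of functions invariant under a map *)

Section InvariantIntegral.
Context d (T : measurableType d) (R : realType).
Variables (mu : {measure set T -> \bar R}) (S : T -> T).
Hypothesis mS : measurable_fun setT S.
Local Open Scope ereal_scope.

Import HBNNSimple.

(** The right-hand side shows that the integral depends on [g] only through its integrals over
    preimages under [S]. *)
Let integral_comp_mul (f g : T -> R)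
    (mf : measurable_fun setT (EFin \o f : T -> \bar R)) :
  (forall x, 0 <= f x)%R -> measurable_fun setT g -> (forall x, 0 <= g x)%R ->
  let h := nnsfun_approx measurableT mf in
  \int[mu]_x ((f (S x))%:E * (g x)%:E) =
  limn (fun n => \sum_(y \in range (h n))
     (y%:E * \int[mu]_(x in S @^-1` (h n @^-1` [set y])) (g x)%:E)).
Proof.
move=> f0 mg g0 h.
have mSpre B : measurable B -> measurable (S @^-1` B).
  by move=> mB; rewrite -[X in measurable X]setTI; exact: mS.
have mhS n : measurable_fun setT (fun x => (h n (S x))%:E).
  by apply/measurable_EFinP; apply: measurableT_comp => //; exact/measurable_funP.
have mge : measurable_fun setT (EFin \o g : T -> \bar R) by exact/measurable_EFinP.
have fg x : (f (S x))%:E * (g x)%:E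
    = limn (fun n => (h n (S x))%:E * (g x)%:E).
  apply/esym/cvg_lim => //; apply: cvgeZr => //.
  exact: (cvg_nnsfun_approx measurableT mf (fun x _ => f0 x) (x := S x) I).
under eq_integral => x _ do rewrite fg.
rewrite monotone_convergence //; last 3 first.
- by move=> n; apply: emeasurable_funM.
- by move=> n x _; rewrite mule_ge0 ?lee_fin.
- move=> x _ a b ab; rewrite lee_wpmul2r ?lee_fin//.
  exact/lefP/nd_nnsfun_approx.
congr (limn _); apply/funext => n.
have E x : (h n (S x))%:E * (g x)%:E = \sum_(y \in range (h n))
    ((y * \1_(h n @^-1` [set y]) (S x))%:E * (g x)%:E).
  rewrite -ge0_mule_fsuml => [|y]; last exact: nnfun_muleindic_ge0.
  by rewrite fsumEFin // -(fimfunE _ (S x)).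
under eq_integral => x _ do rewrite E.
have mi (y : R) : measurable_fun setT
    (fun x => (\1_(h n @^-1` [set y]) (S x) : R)%:E).
  apply/measurable_EFinP; apply: measurableT_comp => //.
rewrite ge0_integral_fsum//; last 2 first.
- move=> y; apply: emeasurable_funM => //.
  under eq_fun do rewrite EFinM.
  by apply: emeasurable_funM => //; exact: measurable_cst.
- by move=> y x _; rewrite mule_ge0 ?nnfun_muleindic_ge0 ?lee_fin.
apply: eq_fsbigr => r rhn.
under eq_integral do rewrite EFinM -muleA.
rewrite ge0_integralZl//.
- congr (_ * _); rewrite [RHS]integral_mkcond; apply: eq_integral => x _.
  rewrite patchE indicE; case: ifPn => xB.
    by rewrite mem_set ?mul1e//; move: xB; rewrite inE.
  rewrite memNset ?mul0e//.
  by move: xB; rewrite notin_setE.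
- exact: emeasurable_funM.
- by move=> t Et; rewrite mule_ge0 ?lee_fin.
- by move: rhn; rewrite inE => -[t _ <-]; rewrite lee_fin.
Qed.

(** The last hypothesis says that [g] and [h] have the same conditional expectation given the
    sigma-algebra generated by [S]; since [f] equals its composition with [S], it is measurable for
    that sigma-algebra. *)
Lemma ge0_integral_invariant (f g h : T -> R) :
  measurable_fun setT f -> (forall x, 0 <= f x)%R -> (forall x, f (S x) = f x) ->
  measurable_fun setT g -> (forall x, 0 <= g x)%R ->
  measurable_fun setT h -> (forall x, 0 <= h x)%R ->
  (forall B, measurable B ->
     \int[mu]_(x in S @^-1` B) (g x)%:E = \int[mu]_(x in S @^-1` B) (h x)%:E) ->
  \int[mu]_x ((f x)%:E * (g x)%:E) = \int[mu]_x ((f x)%:E * (h x)%:E).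
Proof.
move=> mf f0 fS mg g0 mh h0 gh.
have mfe : measurable_fun setT (EFin \o f : T -> \bar R) by exact/measurable_EFinP.
under eq_integral => x _ do rewrite -fS.
under [RHS]eq_integral => x _ do rewrite -fS.
rewrite (integral_comp_mul mfe)// (integral_comp_mul mfe)//.
congr (limn _); apply/funext => n; apply: eq_fsbigr => r _.
by rewrite gh.
Qed.

End InvariantIntegral.

(** * Abstract core: specification against conformality for a countable partition *)

Section SpecificationVsConformality.
Context d (T : measurableType d) (R : realType) (mu : {finite_measure set T -> \bar R}).
Variables (C : nat -> set T) (S : nat -> T -> T) (p : nat -> T -> R).
Hypothesis mC : forall n, measurable (C n).
Hypothesis C_cover : \bigcup_n C n = setT.
Hypothesis C_triv : trivIset setT C.
Hypothesis mS : forall n, measurable_fun setT (S n).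
Hypothesis S_id : forall n x, C n x -> S n x = x.
Hypothesis S_comp : forall n m x, S n (S m x) = S n x.
Hypothesis mp : forall n, measurable_fun setT (p n).
Hypothesis p_gt0 : forall n x, 0 < p n x.
Hypothesis p_inv : forall n m x, p n (S m x) = p n x.
Hypothesis p_sum : forall x, (\sum_(n <oo) (p n x)%:E = 1)%E.
Local Open Scope ereal_scope.

(** In the application the preimages under [S n] are exactly the events off [K], so this makes [p n]
    the conditional probability of [C n] given the outside. *)
Definition specification_eq := forall n B, measurable B ->
  mu (C n `&` S n @^-1` B) = \int[mu]_(x in S n @^-1` B) (p n x)%:E.

Definition conformal_eq := forall n m B, measurable B ->
  mu (C n `&` S m @^-1` B) = \int[mu]_(x in C m `&` B) (p n x / p m x)%:E.

Let mSpre n B : measurable B -> measurable (S n @^-1` B).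
Proof. by move=> mB; rewrite -[X in measurable X]setTI; exact: mS. Qed.

Let mdiv n m : measurable_fun setT (fun x => p n x / p m x)%R.
Proof.
by apply: measurable_funM => //; exact: measurable_fun_inv_gt0.
Qed.

Let CB n B : C n `&` B = S n @^-1` B `&` C n.
Proof.
by apply/seteqP; split => x /= [] => [Cx Bx|+ Cx]; rewrite (S_id Cx).
Qed.

Let indic_inv n m B x : \1_(S n @^-1` B) (S m x) = \1_(S n @^-1` B) x :> R.
Proof.
rewrite !indicE; congr (nat_of_bool _)%:R.
by apply/idP/idP; rewrite !inE /= S_comp.
Qed.

Let int_indic (D : set T) (f : T -> R) : measurable D ->
  \int[mu]_(x in D) (f x)%:E = \int[mu]_x ((\1_D x)%:E * (f x)%:E).
Proof.
move=> mD; rewrite integral_mkcond; apply: eq_integral => x _.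
by rewrite patchE indicE; case: ifPn => _; rewrite ?mul1e ?mul0e.
Qed.

(** The ratio [p n / p m] is invariant under [S m], so by the specification of [C m] its integral
    over [C m] may be taken against [p m] instead, which cancels the denominator. *)
Lemma specification_conformal : specification_eq -> conformal_eq.
Proof.
move=> spec n m B mB; rewrite [in RHS]CB.
have -> : mu (C n `&` S m @^-1` B) =
    \int[mu]_x ((\1_(S m @^-1` B) x)%:E * (p n x)%:E).
  (* A preimage under [S m] is also a preimage under [S n], so the specification of [C n] applies to
     it. *)
  have -> : S m @^-1` B = S n @^-1` (S m @^-1` B).
    by apply/seteqP; split => x /=; rewrite S_comp.
  rewrite spec; last exact: mSpre.
  by rewrite [LHS]int_indic//; exact: (mSpre _ (mSpre m mB)).
rewrite [RHS]int_indic; last by apply: measurableI => //; exact: mSpre.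
pose f x := (\1_(S m @^-1` B) x * (p n x / p m x))%R.
transitivity (\int[mu]_x ((f x)%:E * (\1_(C m) x)%:E)); last first.
  apply: eq_integral => x _; rewrite -!EFinM; congr (_%:E).
  by rewrite /f indicI /= mulrAC.
rewrite (@ge0_integral_invariant _ _ _ _ (S m) _ f _ (p m))//.
- apply: eq_integral => x _; rewrite -!EFinM; congr (_%:E).
  by rewrite /f -!mulrA mulVf ?mulr1// gt_eqF.
- by apply: measurable_funM => //; apply: measurable_indic; exact: mSpre.
- by move=> x; rewrite /f mulr_ge0// divr_ge0// ltW.
- by move=> x; rewrite /f !p_inv indic_inv.
- by move=> x; rewrite ltW.
- move=> B' mB'; rewrite integral_indic//; last exact: mSpre.
  exact: spec.
Qed.

(** Split the mass of [C n] by inserting the sum of all [p m], which is 1. In the m-th summand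
    conformality replaces the indicator of [C n] by that of [C m] times [p n / p m], so that [p m]
    becomes [p n]; the cells [C m] then add up to the whole space. *)
Lemma conformal_specification : conformal_eq -> specification_eq.
Proof.
move=> conf n B mB; set D := S n @^-1` B.
have mD : measurable D by exact: mSpre.
have DE m : S m @^-1` D = D.
  by apply/seteqP; split => x /=; rewrite /D /= S_comp.
(* Conformality says that the two last factors have equal integrals over every preimage under [S m];
   the common factor is invariant under [S m]. *)
have key m : \int[mu]_x ((\1_D x * p m x)%:E * (\1_(C n) x)%:E) =
    \int[mu]_x ((\1_D x * p m x)%:E * (\1_(C m) x * (p n x / p m x))%:E).
  apply: (@ge0_integral_invariant _ _ _ _ (S m)) => //.
  - by apply: measurable_funM => //; exact: measurable_indic.
  - by move=> x; rewrite mulr_ge0// ltW.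
  - by move=> x; rewrite !p_inv indic_inv.
  - by apply: measurable_funM => //; exact: measurable_indic.
  - by move=> x; rewrite mulr_ge0// divr_ge0// ltW.
  - move=> B' mB'; rewrite integral_indic//; last exact: mSpre.
    rewrite [LHS]conf// CB integral_mkcondr; apply: eq_integral => x _.
    by rewrite patchE indicE; case: ifPn => _; rewrite ?mul1r ?mul0r.
have -> : mu (C n `&` D) =
    \sum_(m <oo) \int[mu]_x ((\1_D x * p m x)%:E * (\1_(C n) x)%:E).
  rewrite -integral_nneseries//; last 2 first.
  - move=> m; apply/measurable_EFinP.
    apply: measurable_funM; last exact: measurable_indic.
    by apply: measurable_funM => //; exact: measurable_indic.
  - by move=> m x _; rewrite -EFinM lee_fin !mulr_ge0// ltW.
  transitivity (\int[mu]_x (\1_(C n `&` D) x)%:E).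
    by rewrite integral_indic ?setIT//; exact: measurableI.
  apply: eq_integral => x _.
  transitivity (\sum_(m <oo) ((\1_(C n `&` D) x)%:E * (p m x)%:E)).
    rewrite nneseriesZl// ?p_sum ?mule1//.
    by move=> m _; rewrite lee_fin ltW.
  apply: eq_eseriesr => m _; rewrite -!EFinM; congr (_%:E).
  by rewrite indicI /= -[LHS]mulrA mulrC.
under eq_eseriesr do rewrite key.
transitivity (\sum_(m <oo) \int[mu]_(x in D `&` C m) (p n x)%:E).
  apply: eq_eseriesr => m _; rewrite [RHS]int_indic; last exact: measurableI.
  apply: eq_integral => x _; rewrite -!EFinM; congr (_%:E).
  by rewrite indicI /=; field; rewrite gt_eqF.
rewrite -ge0_integral_bigcup//.
- by rewrite -setI_bigcupr C_cover setIT.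
- by move=> m; exact: measurableI.
- by apply: measurable_funTS; exact/measurable_EFinP.
- by move=> x _; rewrite lee_fin ltW.
- exact: trivIset_setIl.
Qed.

End SpecificationVsConformality.

                                        

(** * Coordinate sigma-algebras and Borel sets of configurations *)

Section ConfigMeasurability.
Context (G : groupType).
Implicit Types (D : set G) (F K : {fset G}) (B : set (config G)).

Lemma sigma_algebra_coord D : sigma_algebra setT (coord_sigma D).
Proof. exact: smallest_sigma_algebra. Qed.

Lemma coord_sigma0 D : coord_sigma D set0.
Proof. by case: (sigma_algebra_coord D). Qed.

Arguments coord_sigma0 : clear implicits.

Lemma coord_sigmaC D B : coord_sigma D B -> coord_sigma D (~` B).
Proof. by case: (sigma_algebra_coord D) => _ DC _ DB; rewrite -setTD; exact: DC. Qed.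

Arguments coord_sigmaC {D B} _.

Lemma coord_sigma_bigcup D (B_ : nat -> set (config G)) :
  (forall n, coord_sigma D (B_ n)) -> coord_sigma D (\bigcup_n B_ n).
Proof. by case: (sigma_algebra_coord D) => _ _; exact. Qed.

Arguments coord_sigma_bigcup {D B_} _.

Lemma coord_sigmaT D : coord_sigma D setT.
Proof. by rewrite -setC0; exact: coord_sigmaC (coord_sigma0 D). Qed.

Arguments coord_sigmaT : clear implicits.

Lemma coord_sigmaI D B B' :
  coord_sigma D B -> coord_sigma D B' -> coord_sigma D (B `&` B').
Proof.
move=> DB DB'; rewrite -(setCK (B `&` B')) setCI -bigcup2E.
by apply: coord_sigmaC; apply: coord_sigma_bigcup => -[|[|n]] /=;
  [exact: coord_sigmaC|exact: coord_sigmaC|exact: (coord_sigma0 _)].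
Qed.

Arguments coord_sigmaI {D B B'} _ _.

Lemma coord_sigma_coord D g (V : set nat) :
  D g -> coord_sigma D [set x : config G | V (x g)].
Proof. by move=> Dg; apply: sub_sigma_algebra; exists g => //; exists V. Qed.

Arguments coord_sigma_coord {D g} V _.

Lemma coord_sigmaS D D' : D `<=` D' -> coord_sigma D `<=` coord_sigma D'.
Proof.
move=> DD'; apply: smallest_sub; first exact: sigma_algebra_coord.
by move=> _ [g Dg [V ->]]; apply: coord_sigma_coord; exact: DD'.
Qed.

Arguments coord_sigmaS {D D'} _ _ _.

Lemma coord_sigma_cylinder F (y : config G) :
  coord_sigma [set` F] [set x : config G | forall g, g \in F -> x g = y g].
Proof.
suff : forall s : seq G, {subset s <= F} ->
    coord_sigma [set` F] [set x : config G | forall g, g \in s -> x g = y g].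
  by apply => g.
elim=> [_|h s IHs sF].
  rewrite [X in coord_sigma _ X](_ : _ = setT); first exact: (coord_sigmaT _).
  by apply/seteqP; split.
rewrite [X in coord_sigma _ X](_ : _ = [set x : config G | [set y h] (x h)] `&`
    [set x : config G | forall g, g \in s -> x g = y g]).
  apply: coord_sigmaI; last by apply: IHs => g gs; rewrite sF// inE gs orbT.
  by apply: (coord_sigma_coord [set y h]); apply: sF; rewrite inE eqxx.
apply/seteqP; split => x /=.
  by move=> xy; split => [|g gs]; apply: xy; rewrite inE ?eqxx// gs orbT.
by case=> xh xs g; rewrite inE => /predU1P[->//|/xs].
Qed.

Arguments coord_sigma_cylinder : clear implicits.

(** There are countably many patterns on [F], so the set is a countable union of cylinders; indices
    that code no pattern contribute the empty set. *)
Lemma coord_sigma_local F B :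
  (forall x y, (forall g, g \in F -> x g = y g) -> B x -> B y) ->
  coord_sigma [set` F] B.
Proof.
move=> BF; pose b (w : {ffun F -> nat}) : config G := splice w (fun=> 0%N).
pose C (n : nat) : set (config G) :=
  if (choice.unpickle n : option {ffun F -> nat}) is Some w then
  [set x : config G | B (b w) /\ forall g, g \in F -> x g = b w g] else set0.
have -> : B = \bigcup_n C n.
  apply/seteqP; split=> [x Bx|x [n _]].
    exists (choice.pickle [ffun g : F => x (val g)]) => //; rewrite /C choice.pickleK.
    have bE g : g \in F -> x g = b [ffun g : F => x (val g)] g.
      by move=> gF; rewrite /b /splice insubT/= ffunE.
    by split=> //; exact: BF Bx.
  rewrite /C; case: choice.unpickle => // w [Bw xw].
  by apply: BF Bw => g gF; rewrite xw.
apply: coord_sigma_bigcup => n; rewrite /C.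
case: choice.unpickle => [w|]; last exact: (coord_sigma0 _).
have [Bw|nBw] := pselect (B (b w)).
  rewrite [X in coord_sigma _ X](_ : _ = [set x : config G | forall g, g \in F -> x g = b w g]).
    exact: (coord_sigma_cylinder _ _).
  by apply/seteqP; split => [x []//|x ?]; split.
rewrite [X in coord_sigma _ X](_ : _ = set0); first exact: (coord_sigma0 _).
by apply/seteqP; split => [x []|].
Qed.

Arguments coord_sigma_local {F B} _.

Lemma nbhs_cylinder (x : {ptws G -> nat}) (B : set {ptws G -> nat}) :
  nbhs x B -> exists F : {fset G}, forall y : {ptws G -> nat},
    (forall g, g \in F -> y g = x g) -> B y.
Proof.
pose cyl F := [set y : {ptws G -> nat} | forall g, g \in F -> y g = x g].
have cylF : Filter (filter_from [set: {fset G}] cyl).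
  apply: filter_from_filter; first by exists fset0.
  move=> F F' _ _; exists (F `|` F')%fset => // y yx.
  by split=> g gF; apply: yx; rewrite inE gF ?orbT.
suff : filter_from [set: {fset G}] cyl --> x.
  by move=> cx /cx[F _ FB]; exists F => y /FB.
apply/cvg_sup => g U [/= _ [[W oW <-]] /= Wx] /filterS; apply.
exists [fset g]%fset => // y /= yx.
by rewrite /proj/= yx ?inE.
Qed.

Lemma measurable_coord_set g (V : set nat) :
  measurable [set x : config G | V (x g)].
Proof.
apply: sub_sigma_algebra.
apply: (@open_comp {ptws G -> nat} nat (proj g) V).
  by move=> x _; exact: proj_continuous.
rewrite openE => a Va; rewrite /interior nbhs_principalE.
exact/principal_filterP.
Qed.

Lemma coord_sigma_measurable D : coord_sigma D `<=` measurable.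
Proof.
apply: smallest_sub; first exact: sigma_algebra_measurable.
by move=> _ [g _ [V ->]]; exact: measurable_coord_set.
Qed.

Variable E : nat -> {fset G}.
Hypothesis hE : exhausting E.

Lemma exhausting_sub m n : (m <= n)%N -> (E m `<=` E n)%fset.
Proof.
case: hE => _ _ Em _; move=> /subnK <-.
elim: (n - m)%N => [|k IHk]; first by rewrite add0n fsubset_refl.
rewrite addSn; apply: (fsubset_trans IHk); exact/fproper_sub/Em.
Qed.

Lemma exhausting_fset F : exists m, (F `<=` E m)%fset.
Proof.
case: hE => _ _ _ Eg.
suff : forall s : seq G, exists m, {subset s <= E m}.
  by move=> /(_ F)[m Fm]; exists m; apply/fsubsetP.
elim=> [|g s [m sm]]; first by exists 0%N.
have [n gn] := Eg g; exists (maxn m n) => h; rewrite inE => /predU1P[->|/sm hm].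
  by apply: (fsubsetP (exhausting_sub (leq_maxr m n))).
by apply: (fsubsetP (exhausting_sub (leq_maxl m n))).
Qed.

(** An open set contains, around each of its points, a cylinder over some [E m]. The points for
    which a given [E m] suffices form a set determined by [E m], and the exhaustion makes the union
    over [m] countable. *)
Lemma measurable_coord_sigma B : measurable B -> coord_sigma setT B.
Proof.
apply: smallest_sub; first exact: sigma_algebra_coord.
move=> {}B oB.
pose A m := [set x : config G |
  forall y : config G, (forall g, g \in E m -> y g = x g) -> B y].
have -> : B = \bigcup_m A m.
  apply/seteqP; split => [x Bx|x [m _]]; last by apply.
  have [F FB] := nbhs_cylinder (open_nbhs_nbhs (conj oB Bx)).
  have [m Fm] := exhausting_fset F.
  by exists m => // y yx; apply: FB => g gF; apply: yx; exact: (fsubsetP Fm).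
apply: coord_sigma_bigcup => m; apply: (@coord_sigmaS [set` E m] setT) => //.
apply: coord_sigma_local => x y xy Ax z zy; apply: Ax => g gE.
by rewrite zy// xy.
Qed.

Arguments measurable_coord_sigma {B} _.

Lemma coord_sigma_preimage D (T : config G -> config G) :
  (forall g (V : set nat), coord_sigma D [set x | V (T x g)]) ->
  forall B, measurable B -> coord_sigma D (T @^-1` B).
Proof.
move=> TD B /measurable_coord_sigma.
suff : coord_sigma setT `<=` [set B | coord_sigma D (T @^-1` B)] by exact.
apply: smallest_sub; last by move=> _ [g _ [V ->]]; exact: TD.
split => /=.
- by rewrite preimage_set0; exact: (coord_sigma0 _).
- by move=> A DA; rewrite setTD preimage_setC; exact: coord_sigmaC.
- by move=> A DA; rewrite preimage_bigcup; exact: coord_sigma_bigcup.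
Qed.

Arguments coord_sigma_preimage {D T} _ {B} _.

Lemma coord_sigma_splice K (w : {ffun K -> nat}) B :
  measurable B -> coord_sigma (~` [set` K]) (splice w @^-1` B).
Proof.
apply: coord_sigma_preimage => g V.
have [gK|gK] := boolP (g \in K); last first.
  rewrite [X in coord_sigma _ X](_ : _ = [set x : config G | V (x g)]).
    by apply: coord_sigma_coord => /=; exact/negP.
  by apply/seteqP; split => x /=; rewrite /splice insubF//; exact: negbTE.
have [Vw|Vw] := pselect (V (w (FSetSub gK))).
  rewrite [X in coord_sigma _ X](_ : _ = setT); first exact: (coord_sigmaT _).
  by apply/seteqP; split => x //= _; rewrite /splice insubT.
rewrite [X in coord_sigma _ X](_ : _ = set0); first exact: (coord_sigma0 _).
by apply/seteqP; split => x //=; rewrite /splice insubT.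
Qed.

Arguments coord_sigma_splice {K} w {B} _.

Lemma measurable_splice K (w : {ffun K -> nat}) :
  measurable_fun setT (splice w : config G -> config G).
Proof.
move=> _ B mB; rewrite setTI.
exact: coord_sigma_measurable (coord_sigma_splice w mB).
Qed.

Lemma measurable_shift g : measurable_fun setT (Defs.shift g : config G -> config G).
Proof.
move=> _ B mB; rewrite setTI; apply: (@coord_sigma_measurable setT).
by apply: coord_sigma_preimage => // h V; exact: coord_sigma_coord.
Qed.

End ConfigMeasurability.

                           

(** * Energy differences under summable variation *)

Section Energy.
Context (R : realType) (G : groupType).
Variables (E : nat -> {fset G}) (phi : config G -> R).
Hypotheses (hE : exhausting E) (hvar : summable_variation E phi).
Implicit Types (x y z : config G) (F K : {fset G}).

Let E1 : E 1%N = [fset 1%g]%fset. Proof. by case: hE. Qed.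

Let c k := #|` fset_inv (E k.+1) `\` fset_inv (E k)|%fset.
Let var k := fine (Defs.variation phi (E k)).

Lemma variation_ge0 F : (0 <= Defs.variation phi F)%E.
Proof.
by apply: ereal_sup_ubound; exists point, point; rewrite subrr normr0.
Qed.

Lemma mem_fset_inv F g : (g \in fset_inv F) = (g^-1%g \in F).
Proof.
apply/imfsetP/idP => [[h hF ->]|gF]; first by rewrite invgK.
by exists g^-1%g => //; rewrite invgK.
Qed.

Let c_gt0 k : (0 < c k)%N.
Proof.
case: hE => _ _ /(_ k); rewrite fproperE => /andP[_ /fsubsetPn[g gE gnE]] _.
rewrite cardfs_gt0; apply/fset0Pn; exists g^-1%g.
by rewrite inE !mem_fset_inv invgK gE andbT.
Qed.

(** The filter [1 <= k] leaves out the empty set [E 0], over which the variation may be infinite. *)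
Let tail M := (\sum_(M <= k <oo | (1 <= k)%N) ((c k)%:R%:E * Defs.variation phi (E k)))%E.

Let term_ge0 k : (0 <= (c k)%:R%:E * Defs.variation phi (E k))%E.
Proof. by rewrite mule_ge0 ?variation_ge0// lee_fin. Qed.

Let tail_cvg : tail M @[M --> \oo] --> 0%E.
Proof.
apply: nneseries_tail_cvg => //.
by move: hvar; rewrite /summable_variation eseries_cond.
Qed.

Let sum_le_tail M N : (1 <= M)%N ->
  (\sum_(M <= k < N) ((c k)%:R%:E * Defs.variation phi (E k)) <= tail M)%E.
Proof.
move=> M1; rewrite /tail.
have := @nneseries_lim_ge R _ (leq 1) M N (fun k _ _ => term_ge0 k).
apply: le_trans; rewrite [leRHS]big_mkcond /= big_nat_cond [leRHS]big_nat_cond.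
apply: lee_sum => k /andP[/andP[Mk _] _].
by rewrite (leq_trans M1).
Qed.

Let tail1_lty : (tail 1 < +oo)%E.
Proof.
move: hvar; rewrite /summable_variation /tail.
rewrite [X in (X < _)%E -> _]eseries_cond [X in _ -> (X < _)%E]eseries_cond.
by under [X in _ -> (X < _)%E]eq_eseriesl do rewrite andbb.
Qed.

Lemma variation_fin_num k : (1 <= k)%N -> Defs.variation phi (E k) \is a fin_num.
Proof.
move=> k1; rewrite ge0_fin_numE ?variation_ge0//.
have : (\sum_(1 <= i < k.+1) ((c i)%:R%:E * Defs.variation phi (E i)) < +oo)%E.
  exact: le_lt_trans (sum_le_tail _ _) tail1_lty.
rewrite big_nat_recr//=.
move=> /(le_lt_trans _); move/(_ ((c k)%:R%:E * Defs.variation phi (E k))%E).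
rewrite leeDr ?sume_ge0// => /(_ isT); apply: le_lt_trans.
by rewrite -[leLHS]mul1e lee_wpmul2r ?variation_ge0// lee_fin ler1n.
Qed.

Let varE k : (1 <= k)%N -> Defs.variation phi (E k) = (var k)%:E.
Proof. by move=> k1; rewrite fineK ?variation_fin_num. Qed.

Let var_ge0 k : 0 <= var k.
Proof. exact/fine_ge0/variation_ge0. Qed.

Let sumE M N : (1 <= M)%N ->
  (\sum_(M <= k < N) ((c k)%:R%:E * Defs.variation phi (E k)) =
   (\sum_(M <= k < N) (c k)%:R * var k)%:E)%E.
Proof.
move=> M1; rewrite -sumEFin; apply: eq_big_nat => k /andP[Mk _].
by rewrite varE// (leq_trans M1).
Qed.

Let small_tail (e : R) : 0 < e -> exists2 M, (1 <= M)%N &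
  forall N, \sum_(M <= k < N) (c k)%:R * var k <= e.
Proof.
move=> e0; have e0' : (0 < e%:E)%E by rewrite lte_fin.
have [M0 _ M0P] := tail_cvg (open_ereal_lt' e0'); exists (maxn 1 M0); first exact: leq_maxl.
move=> N; rewrite -lee_fin -sumE ?leq_maxl//.
apply: le_trans (sum_le_tail _ (leq_maxl _ _)) _.
by apply/ltW/M0P; exact: leq_maxr.
Qed.

Let total_bound : exists V : R, forall N, \sum_(1 <= k < N) (c k)%:R * var k <= V.
Proof.
exists (fine (tail 1)) => N; rewrite -lee_fin -sumE// fineK.
  exact: sum_le_tail.
by rewrite ge0_fin_numE ?nneseries_ge0.
Qed.

(** Strict growth of [E] gives each variation a coefficient of at least 1, so it is bounded by a
    tail of the series. *)
Lemma variation_small (e : R) : 0 < e ->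
  exists2 M, (1 <= M)%N & forall k, (M <= k)%N -> (Defs.variation phi (E k) <= e%:E)%E.
Proof.
move=> /small_tail[M M1 MP]; exists M => // k Mk.
rewrite varE ?(leq_trans M1)// lee_fin; apply: le_trans (MP k.+1).
rewrite big_nat_recr//= -[leLHS]add0r lerD ?sumr_ge0//.
  by move=> i _; rewrite mulr_ge0.
by rewrite -[leLHS]mul1r ler_wpM2r// ler1n.
Qed.

Lemma le_variation F x y : (forall g, g \in F -> x g = y g) ->
  (`|phi x - phi y|%:E <= Defs.variation phi F)%E.
Proof. by move=> xy; apply: ereal_sup_ubound; exists x, y. Qed.

(** Setting the coordinates off [E m] to 0 before applying [phi] gives a function of finitely many
    coordinates, and these functions converge to [phi] because the variations tend to 0. *)
Lemma measurable_potential : measurable_fun setT phi.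
Proof.
pose r m x : config G := fun g => if g \in E m then x g else 0%N.
apply: (@measurable_fun_cvg _ _ _ _ (fun m => phi \o r m)) => [m|x _].
  move=> _ V mV; rewrite setTI; apply: (@coord_sigma_measurable _ [set` E m]).
  apply: coord_sigma_local => x y xy /=.
  rewrite (_ : r m x = r m y)//; apply/funext => g; rewrite /r.
  by case: ifP => // /xy.
apply/cvgrPdist_le => e e0; have [M M1 MP] := variation_small e0.
exists M => // m /= Mm; rewrite -lee_fin.
apply: le_trans (MP m Mm); apply: le_variation => g gE.
by rewrite /r gE.
Qed.

                                                                             
                                                 
(** If x and y agree off [K] and [g] lies outside this set, then the translates of x and y by [g]
    agree on [E N]. *)
Let T K N := [fset (p.1 * p.2)%g | p in fset_inv (E N) `*` K]%fset.

Let memT K N g :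
  reflect (exists2 h, h \in E N & (h * g)%g \in K) (g \in T K N).
Proof.
apply: (iffP idP) => [/imfsetP[[a b] /=]|[h hE' hgK]].
  rewrite inE /= mem_fset_inv => /andP[aE bK] ->.
  by exists a^-1%g => //; rewrite mulKg.
apply/imfsetP; exists (h^-1, h * g)%g; last by rewrite /= mulKg.
by rewrite inE /= mem_fset_inv invgK hE'.
Qed.

Let T_sub K M N : (M <= N)%N -> (T K M `<=` T K N)%fset.
Proof.
move=> MN; apply/fsubsetP => g /memT[h hM hg]; apply/memT; exists h => //.
exact: (fsubsetP (exhausting_sub hE MN)).
Qed.

Let T1 K : T K 1 = K.
Proof.
apply/fsetP => g; apply/memT/idP => [[h]|gK].
  by rewrite E1 inE => /eqP ->; rewrite mul1g.
by exists 1%g; rewrite ?mul1g// E1 inE.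
Qed.

(** A new element is a product of a new inverse and an element of [K]. This is where the inverses in
    the definition of summable variation come from. *)
Let card_T K N : (#|` T K N.+1 `\` T K N| <= #|` K| * c N)%fset%N.
Proof.
rewrite mulnC -(size_allpairs (fun a b => a * b)%g); apply: uniq_leq_size => // g.
rewrite inE => /andP[gN /imfsetP[[a b]]].
rewrite inE /= => /andP[aE bK] gab; apply/allpairsP; exists (a, b); split => //=.
rewrite inE aE andbT; apply: contra gN => aN.
by rewrite gab; apply/imfsetP; exists (a, b) => //; rewrite inE/= aN.
Qed.

Definition agree_off K x y := forall g, g \notin K -> x g = y g.

Let dist_shift K N x y g : (1 <= N)%N -> agree_off K x y -> g \notin T K N ->
  `|phi (Defs.shift g x) - phi (Defs.shift g y)| <= var N.
Proof.
move=> N1 xy gT; rewrite -lee_fin -varE//; apply: le_variation => h hE'.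
by apply: xy; apply: contra gT => hgK; apply/memT; exists h.
Qed.

(** Each shell between [T K k] and [T K k.+1] has at most [#|K| * c k] elements, and each of them
    contributes at most [var k]. *)
Let sum_shell K M N x y : (1 <= M <= N)%N -> agree_off K x y ->
  \sum_(g <- (T K N `\` T K M)%fset)
     `|phi (Defs.shift g x) - phi (Defs.shift g y)| <=
  #|` K|%:R * \sum_(M <= k < N) (c k)%:R * var k.
Proof.
move=> /andP[M1 MN] xy; rewrite -(subnK MN).
elim: (N - M)%N => [|n IHn].
  by rewrite add0n fsetDv big_geq// mulr0 big_seq_fset0.
rewrite addSn; set N' := (n + M)%N in IHn *.
have MN' : (M <= N')%N by exact: leq_addl.
rewrite big_nat_recr//= mulrDr.
rewrite (big_fsetID _ (mem (T K N')))/=; apply: lerD.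
  rewrite (_ : [fset _ in _ | _]%fset = (T K N' `\` T K M)%fset)//.
  apply/fsetP => g; rewrite !inE /= -andbA; congr (_ && _).
  by apply/andP/idP => [[]//|gN]; split => //; apply: (fsubsetP (T_sub K (leqnSn N'))).
apply: (@le_trans _ _ (\sum_(g <- (T K N'.+1 `\` T K N')%fset) var N')).
  rewrite (_ : [fset _ in _ | _]%fset = (T K N'.+1 `\` T K N')%fset); last first.
    apply/fsetP => g; rewrite !inE /= andbC andbA; congr (_ && _).
    apply/andP/idP => [[]//|gN]; split => //.
    by apply: contra gN; exact: (fsubsetP (T_sub K MN')).
  rewrite big_seq [leRHS]big_seq; apply: ler_sum => g; rewrite inE => /andP[gN _].
  exact: (dist_shift (leq_trans M1 MN') xy gN).
rewrite big_const_seq count_predT iter_addr_0 -[leLHS]mulr_natl.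
by rewrite [leRHS]mulrA ler_wpM2r// -natrM ler_nat card_T.
Qed.

Let ler_sum_fset (A B : {fset G}) (f : G -> R) : (A `<=` B)%fset ->
  (forall g, 0 <= f g) -> \sum_(g <- A) f g <= \sum_(g <- B) f g.
Proof.
move=> AB f0; rewrite [leRHS](big_fsetID _ (mem A))/=.
rewrite (_ : [fset _ in B | _]%fset = A) ?lerDl ?sumr_ge0//.
apply/fsetP => g; rewrite !inE /= andbC.
by apply/andP/idP => [[]//|gA]; rewrite gA (fsubsetP AB).
Qed.

Let sum_off K M F x y : (1 <= M)%N -> K != fset0 -> agree_off K x y ->
    (forall g, g \in F -> g \notin T K M) ->
  exists N, \sum_(g <- F) `|phi (Defs.shift g x) - phi (Defs.shift g y)| <=
  #|` K|%:R * \sum_(M <= k < N) (c k)%:R * var k.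
Proof.
move=> M1 /fset0Pn[k kK] xy FM.
(* With [k] fixed in [K], an element [g] belongs to [T K N] as soon as [E N] contains [k * g^-1]. *)
have [N0 FN0] := exhausting_fset hE [fset (k * g^-1)%g | g in F]%fset.
exists (maxn M N0).
apply: le_trans (sum_shell (N := maxn M N0) _ xy); last by rewrite M1 leq_maxl.
apply: ler_sum_fset => //; apply/fsubsetP => g gF; rewrite inE FM//=.
apply/memT; exists (k * g^-1)%g; last by rewrite mulgVK.
apply: (fsubsetP (exhausting_sub hE (leq_maxr M N0))).
by apply: (fsubsetP FN0); apply/imfsetP; exists g.
Qed.

Definition energy_seq x y m := birkhoff phi (E m) x - birkhoff phi (E m) y.

Let energy_seqB x y m n : (m <= n)%N ->
  energy_seq x y n - energy_seq x y m = \sum_(g <- (E n `\` E m)%fset)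
    (phi (Defs.shift g x) - phi (Defs.shift g y)).
Proof.
move=> mn; rewrite /energy_seq /birkhoff -!sumrB.
rewrite [X in X - _](big_fsetID _ (mem (E m)))/=.
rewrite (_ : [fset _ in E n | _ \in _]%fset = E m); last first.
  apply/fsetP => g; rewrite !inE /= andbC.
  by apply/andP/idP => [[]//|gE]; rewrite gE (fsubsetP (exhausting_sub hE mn)).
rewrite [LHS]addrC addKr.
rewrite (_ : [fset _ in E n | _]%fset = (E n `\` E m)%fset)//.
by apply/fsetP => g; rewrite !inE /= andbC.
Qed.

(** Once [E m] contains [T K M], later increments involve only translates outside [T K M] and are
    bounded by [#|K|] times a tail. The rank [m0] is uniform in x and y, which later controls all
    patterns on [K] at once. *)
Lemma energy_seq_cauchy K (e : R) : K != fset0 -> 0 < e -> exists m0,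
  forall m n x y, (m0 <= m <= n)%N -> agree_off K x y ->
  `|energy_seq x y n - energy_seq x y m| <= e.
Proof.
move=> K0 e0; have cK : 0 < (#|` K|%:R : R) by rewrite ltr0n cardfs_gt0.
have [M M1 MP] := small_tail (divr_gt0 e0 cK).
have [m0 Tm0] := exhausting_fset hE (T K M); exists m0.
move=> m n x y /andP[m0m mn] xy; rewrite energy_seqB//.
apply: le_trans (ler_norm_sum _ _ _) _.
have [|N] := @sum_off K M (E n `\` E m)%fset x y M1 K0 xy.
  move=> g; rewrite inE => /andP[gm _]; apply: contra gm => gT.
  exact: (fsubsetP (exhausting_sub hE m0m)) (fsubsetP Tm0 _ gT).
move=> /le_trans; apply; apply: (@le_trans _ _ (#|` K|%:R * (e / #|` K|%:R))).
  by rewrite ler_wpM2l.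
by rewrite mulrCA divff ?mulr1// gt_eqF.
Qed.

Definition energy x y := limn (energy_seq x y).

Lemma energy_cvg K x y : K != fset0 -> agree_off K x y ->
  energy_seq x y @ \oo --> energy x y.
Proof.
move=> K0 xy; apply/cauchy_cvgP/cauchy_exP => e e0.
have [m0 m0P] := energy_seq_cauchy K0 (divr_gt0 e0 (ltr0Sn _ 1)).
exists (energy_seq x y m0), m0 => // n /= m0n.
rewrite /ball/= distrC; apply: (le_lt_trans (m0P m0 n _ _ _ xy)).
  by rewrite leqnn.
by rewrite ltr_pdivrMr// ltr_pMr// ltr1n.
Qed.

Lemma energy_approx K (e : R) : K != fset0 -> 0 < e -> exists m0,
  forall m x y, (m0 <= m)%N -> agree_off K x y ->
  `|energy x y - energy_seq x y m| <= e.
Proof.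
move=> K0 e0; have [m0 m0P] := energy_seq_cauchy K0 e0.
exists m0 => m x y m0m xy.
have cv : `|energy_seq x y n - energy_seq x y m| @[n --> \oo]
    --> `|energy x y - energy_seq x y m|.
  by apply: cvg_norm; apply: cvgB; [exact: energy_cvg xy|exact: cvg_cst].
rewrite -(cvg_lim _ cv)//; apply: limr_le; first by apply/cvg_ex; eexists; exact: cv.
by exists m => // n /= mn; apply: m0P => //; rewrite m0m.
Qed.

Lemma energyD K x y z : K != fset0 -> agree_off K x y -> agree_off K y z ->
  energy x z = energy x y + energy y z.
Proof.
move=> K0 xy yz; apply/cvg_lim => //.
have -> : energy_seq x z = energy_seq x y \+ energy_seq y z.
  by apply/funext => m; rewrite /energy_seq /= addrA subrK.
by apply: cvgD; exact: (energy_cvg (K := K)).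
Qed.

(** The translates by elements of [K] move a changed coordinate to the identity, so no variation
    over [E k] with [k >= 1] bounds them. They are kept explicit, for exp-summability to control;
    all others are bounded by [#|K|] times the whole series. *)
Lemma energy_le K : K != fset0 -> exists V : R, forall x y, agree_off K x y ->
  energy x y <= V + \sum_(g <- K) (phi (Defs.shift g x) - phi (Defs.shift g y)).
Proof.
move=> K0; have [V VP] := total_bound; exists (#|` K|%:R * V) => x y xy.
have [m0 Km0] := exhausting_fset hE K.
apply: limr_le; first by apply/cvg_ex; eexists; exact: energy_cvg xy.
exists m0 => // n /= m0n.
rewrite /energy_seq /birkhoff -!sumrB (big_fsetID _ (mem K))/=.
rewrite (_ : [fset _ in E n | _ \in _]%fset = K); last first.
  apply/fsetP => g; rewrite !inE /= andbC; apply/andP/idP => [[]//|gK].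
  by rewrite gK (fsubsetP (exhausting_sub hE m0n))// (fsubsetP Km0).
rewrite addrC lerD2r; apply: le_trans (ler_norm _) _.
apply: le_trans (ler_norm_sum _ _ _) _.
(* Since [E 1] contains only the identity, [T K 1] is [K]. *)
have [|N] := @sum_off K 1 [fset g in E n | g \notin K]%fset x y isT K0 xy.
  by move=> g; rewrite !inE /= T1 => /andP[].
by move=> /le_trans; apply; rewrite ler_wpM2l.
Qed.

Lemma measurable_energy_seq (f h : config G -> config G) m :
  measurable_fun setT f -> measurable_fun setT h ->
  measurable_fun setT (fun x => energy_seq (f x) (h x) m).
Proof.
have mb (k : config G -> config G) : measurable_fun setT k ->
    measurable_fun setT (fun x => birkhoff phi (E m) (k x)).
  move=> mk; apply: measurable_sum => g.
  apply: measurableT_comp; first exact: measurable_potential.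
  by apply: measurableT_comp => //; exact: measurable_shift hE _.
by move=> mf mh; apply: measurable_funB; exact: mb.
Qed.

Lemma measurable_energy K (f h : config G -> config G) : K != fset0 ->
  (forall x, agree_off K (f x) (h x)) ->
  measurable_fun setT f -> measurable_fun setT h ->
  measurable_fun setT (fun x => energy (f x) (h x)).
Proof.
move=> K0 fh mf mh.
apply: (@measurable_fun_cvg _ _ _ _ (fun m x => energy_seq (f x) (h x) m)).
  by move=> m; exact: measurable_energy_seq.
by move=> x _; exact: energy_cvg (fh x).
Qed.

End Energy.

                                     

(** * Splicing patterns into configurations *)

Section Splice.
Context (G : groupType) (K : {fset G}).
Implicit Types (x : config G) (w v : {ffun K -> nat}).

Definition cylinder w : set (config G) :=
  [set x | forall h : K, x (val h) = w h].

Lemma splice_in w x (h : K) : splice w x (val h) = w h.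
Proof. by rewrite /splice valK. Qed.

Lemma splice_out w x g : g \notin K -> splice w x g = x g.
Proof. by move=> gK; rewrite /splice insubN. Qed.

Lemma splice_splice w v x : splice w (splice v x) = splice w x.
Proof.
apply/funext => g; have [gK|gK] := boolP (g \in K).
  by rewrite -[g]/(val [` gK]%fset) !splice_in.
by rewrite !splice_out.
Qed.

Lemma splice_cylinder w x : cylinder w (splice w x).
Proof. by move=> h; rewrite splice_in. Qed.

Lemma splice_id w x : cylinder w x -> splice w x = x.
Proof.
move=> wx; apply/funext => g; have [gK|gK] := boolP (g \in K).
  by rewrite -[g]/(val [` gK]%fset) splice_in wx.
by rewrite splice_out.
Qed.

Lemma agree_off_splice w v x : agree_off K (splice w x) (splice v x).
Proof. by move=> g gK; rewrite !splice_out. Qed.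

Lemma measurable_cylinder w : measurable (cylinder w).
Proof.
rewrite (_ : cylinder w =
    [set x : config G | forall g, g \in K -> x g = splice w (fun=> 0%N) g]).
  by apply: (@coord_sigma_measurable _ [set` K]); exact: (@coord_sigma_cylinder G K).
apply/seteqP; split => x /= wx.
  by move=> g gK; rewrite -[g]/(val [` gK]%fset) splice_in wx.
by move=> h; rewrite wx ?splice_in// (valP h).
Qed.

End Splice.

(** Numerator and denominator are each known up to a factor [expR e] either way, after the common
    scaling [c]; hence the quotient is known up to the square of that factor. Since [n / z] is at
    most 1, this relative error is also an absolute one. *)
Lemma ratio_near (R : realType) (n z nm zm c e : R) :
  0 <= n <= z -> 0 < z -> 0 < c ->
  expR (- e) * c * n <= nm <= expR e * c * n ->
  expR (- e) * c * z <= zm <= expR e * c * z ->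
  `|n / z - nm / zm| <= expR (e *+ 2) - 1.
Proof.
move=> /andP[n0 nz] z0 c0 /andP[nm1 nm2] /andP[zm1 zm2].
rewrite expRN in nm1 zm1; rewrite mulr2n expRD.
have : 0 < expR e by exact: expR_gt0.
move: (expR e) nm1 nm2 zm1 zm2 => t nm1 nm2 zm1 zm2 t0.
have zm0 : 0 < zm by apply: lt_le_trans zm1; rewrite !mulr_gt0 ?invr_gt0.
have r1 : n / z <= 1 by rewrite ler_pdivrMr ?mul1r.
have r0 : 0 <= n / z by rewrite divr_ge0// ltW.
have t1 : 1 <= t * t.
  have := le_trans zm1 zm2; rewrite !ler_pM2r// => h.
  by move: h; rewrite -(ler_pM2l t0) divff// gt_eqF.
have up : nm / zm <= t * t * (n / z).
  rewrite ler_pdivrMr//; apply: (le_trans nm2).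
  have -> : t * c * n = t * t * (n / z) * (t^-1 * c * z).
    by field; rewrite !gt_eqF.
  by rewrite ler_wpM2l// mulr_ge0// mulr_ge0// ltW.
have lo : (t * t)^-1 * (n / z) <= nm / zm.
  rewrite ler_pdivlMr//; apply: le_trans nm1.
  have -> : t^-1 * c * n = (t * t)^-1 * (n / z) * (t * c * z).
    by field; rewrite !gt_eqF.
  by rewrite ler_wpM2l// mulr_ge0// invr_ge0 mulr_ge0// ltW.
have b0 : 0 < (t * t)^-1 by rewrite invr_gt0 mulr_gt0.
have ab : t * t * (t * t)^-1 = 1 by rewrite divff// gt_eqF// mulr_gt0.
move: (t * t) (t * t)^-1 (n / z) (nm / zm) t1 b0 ab r0 r1 up lo => a b r q.
by move=> *; rewrite ler_norml; apply/andP; split; nra.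
Qed.

(** * Weights of patterns and their summability *)

Section Weights.
Context (R : realType) (G : groupType).
Variables (E : nat -> {fset G}) (phi : config G -> R).
Hypotheses (hE : exhausting E) (hvar : summable_variation E phi).
Hypothesis (hexp : exp_summable phi).
Variables (K : {fset G}) (K0 : K != fset0).
Implicit Types (x : config G) (w v : {ffun K -> nat}).

Let base : {ffun K -> nat} := [ffun=> 0%N].

(** The Boltzmann weight relative to the zero pattern: the Birkhoff sums themselves need not
    converge, but this difference does, and the reference factor cancels in the Gibbs ratios. *)
Definition weight w x := expR (energy E phi (splice w x) (splice base x)).

Lemma weight_gt0 w x : 0 < weight w x. Proof. exact: expR_gt0. Qed.

Lemma weight_splice w v x : weight w (splice v x) = weight w x.
Proof. by rewrite /weight !splice_splice. Qed.

Lemma measurable_weight w : measurable_fun setT (weight w).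
Proof.
apply: measurableT_comp => //; apply: (measurable_energy hE hvar K0).
- by move=> x; exact: agree_off_splice.
- exact: measurable_splice hE _ _.
- exact: measurable_splice hE _ _.
Qed.

Let top a := expeR (ereal_sup [set (phi x)%:E | x in [set x : config G | x 1%g = a]]).

Let top_ge0 a : (0 <= top a)%E. Proof. exact: expeR_ge0. Qed.

Let topE : exists2 b : nat -> R, (forall x, expR (phi x) <= b (x 1%g)) &
  exists B, forall N, \sum_(a < N) b a <= B.
Proof.
have top_fin a : top a \is a fin_num.
  rewrite ge0_fin_numE//; apply: le_lt_trans hexp.
  apply: le_trans; last exact: (nneseries_lim_ge a.+1 (fun n _ _ => top_ge0 n)).
  by rewrite big_nat_recr//= leeDr// sume_ge0.
exists (fine \o top) => [x|].
  rewrite -lee_fin /= fineK// -[leLHS]/(expeR (phi x)%:E) lee_expeR.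
  by apply: ereal_sup_ubound; exists x.
exists (fine (\sum_(0 <= a <oo) top a)%E) => N.
rewrite -lee_fin fineK; last first.
  by rewrite ge0_fin_numE ?nneseries_ge0.
rewrite -sumEFin; under eq_bigr do rewrite /= fineK//.
rewrite -(big_mkord xpredT top).
exact: (nneseries_lim_ge N (fun n _ _ => top_ge0 n)).
Qed.

(** In [energy_le] the pattern enters only through the translates by sites h of [K]. Translation by
    h brings the symbol [w h] to the identity, where [b] bounds the exponential of [phi]. *)
Lemma weight_le : exists (C : config G -> R) (b : nat -> R),
  [/\ forall x, 0 <= C x, forall a, 0 <= b a,
      forall w x, weight w x <= C x * \prod_(h : K) b (w h) &
      exists B, forall N, \sum_(a < N) b a <= B].
Proof.
have [b bP bB] := topE.
have [V VP] := energy_le hE hvar K0.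
exists (fun x => expR (V - \sum_(h : K) phi (Defs.shift (val h) (splice base x)))), b.
split=> // [a|w x].
  exact: le_trans (expR_ge0 _) (bP (fun=> a)).
rewrite /weight; apply: (@le_trans _ _ (expR (V + \sum_(g <- K)
    (phi (Defs.shift g (splice w x)) - phi (Defs.shift g (splice base x)))))).
  by rewrite ler_expR; apply: VP; exact: agree_off_splice.
rewrite big_seq_fsetE sumrB addrCA addrC [leLHS]expRD expR_sum.
rewrite ler_pM2l ?expR_gt0//; apply: ler_prod => h _; rewrite expR_ge0/=.
apply: le_trans (bP _) _; rewrite /Defs.shift mul1g.
by rewrite splice_in.
Qed.

(** Finitely many patterns have symbols bounded by some [N]. Over all patterns with this bound the
    sum of products is a product of sums, at most [B ^+ #|K|] whatever [N] is. *)
Lemma weight_summable x : (\esum_(w in [set: {ffun K -> nat}]) (weight w x)%:E < +oo)%E.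
Proof.
have [C [b [C0 b0 wb [B bB]]]] := weight_le.
apply: (@le_lt_trans _ _ (C x * B ^+ #|{: K}|)%:E); last exact: ltry.
apply: ge_ereal_sup => _ [X [finX _] <-].
rewrite fsbig_finite//= sumEFin lee_fin.
apply: (@le_trans _ _ (\sum_(w <- fset_set X) (C x * \prod_(h : K) b (w h)))).
  exact: ler_sum.
rewrite -mulr_sumr ler_wpM2l//.
have [N NP] : exists N, forall w, w \in fset_set X -> forall h, (w h <= N)%N.
  exists (\max_(w <- fset_set X) \max_(h : K) w h) => w wX h.
  apply: leq_trans (leq_bigmax_seq (F := fun w : {ffun K -> nat} => \max_(h : K) w h) _ wX isT).
  exact: (leq_bigmax (F := fun h : K => w h)).
pose J w : {ffun K -> 'I_N.+1} := [ffun h => inord (w h)].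
have JE w h : w \in fset_set X -> J w h = w h :> nat.
  by move=> wX; rewrite ffunE inordK// ltnS NP.
rewrite big_seq.
under eq_bigr => w wX do under eq_bigr => h _ do rewrite -JE//.
rewrite -big_seq -(big_map J xpredT (fun f : {ffun K -> 'I_N.+1} => \prod_(h : K) b (f h))).
rewrite big_uniq; last first.
  rewrite map_inj_in_uniq ?fset_uniq// => w v wX vX /ffunP wv.
  by apply/ffunP => h; rewrite -JE// wv JE.
apply: (@le_trans _ _ (\sum_(f : {ffun K -> 'I_N.+1}) \prod_(h : K) b (f h))).
  rewrite [leRHS](bigID (mem (map J (fset_set X))))/= lerDl.
  by rewrite sumr_ge0// => f _; rewrite prodr_ge0.
rewrite -(bigA_distr_bigA (fun (h : K) (a : 'I_N.+1) => b a)).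
rewrite prodr_const lerXn2r// nnegrE ?sumr_ge0//.
by apply: le_trans (bB 0%N); rewrite big_ord0.
Qed.

End Weights.

(** * The Gibbs kernel as an explicit series *)

Section GibbsKernel.
Context (R : realType) (G : groupType).
Variables (E : nat -> {fset G}) (phi : config G -> R).
Hypotheses (hE : exhausting E) (hvar : summable_variation E phi).
Hypothesis (hexp : exp_summable phi).
Variables (K : {fset G}) (K0 : K != fset0).
Variables (e : nat -> {ffun K -> nat}) (e_bij : set_bij setT setT e).
Implicit Types (x : config G) (B : set (config G)) (w : {ffun K -> nat}).
Local Notation wt := (@weight R G E phi K).
Let base : {ffun K -> nat} := [ffun=> 0%N].

Let esum_e (a : {ffun K -> nat} -> \bar R) : (forall w, (0 <= a w)%E) ->
  (\esum_(w in [set: {ffun K -> nat}]) a w = \sum_(n <oo) a (e n))%E.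
Proof. by move=> a0; rewrite (reindex_esum setT _ _ _ e_bij) nneseries_esumT. Qed.

Let wt_ge0 w x : 0 <= wt w x :> R. Proof. exact/ltW/weight_gt0. Qed.

Let wsum B x := (\sum_(n <oo) (wt (e n) x * \1_B (splice (e n) x))%:E)%E.

Let wsum_ge0 B x : (0 <= wsum B x)%E.
Proof. by apply: nneseries_ge0 => n _ _; rewrite lee_fin mulr_ge0. Qed.

Let wsumT x : wsum setT x = (\sum_(n <oo) (wt (e n) x)%:E)%E.
Proof. by apply: eq_eseriesr => n _; rewrite indicT mulr1. Qed.

Let wsum_le B x : (wsum B x <= wsum setT x)%E.
Proof.
apply: lee_nneseries => [n _|n _]; rewrite lee_fin ?mulr_ge0//.
by rewrite indicT mulr1 ler_piMr// indicE lern1 leq_b1.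
Qed.

Let wsumT_lty x : (wsum setT x < +oo)%E.
Proof.
rewrite wsumT -(esum_e (a := fun w => (wt w x)%:E)); last first.
  by move=> w; rewrite lee_fin.
exact: weight_summable.
Qed.

Let wsum_fin B x : wsum B x \is a fin_num.
Proof. by rewrite ge0_fin_numE// (le_lt_trans (wsum_le B x)). Qed.

Definition partition_fun x : R := fine (\sum_(n <oo) (wt (e n) x)%:E)%E.

Lemma partition_funE x :
  (\sum_(n <oo) (wt (e n) x)%:E)%E = (partition_fun x)%:E.
Proof. by rewrite /partition_fun -wsumT fineK. Qed.

Lemma partition_fun_gt0 x : 0 < partition_fun x.
Proof.
rewrite -lte_fin -partition_funE.
apply: (@lt_le_trans _ _ (wt (e 0%N) x)%:E); first by rewrite lte_fin weight_gt0.
have wE0 n : (0 <= (wt (e n) x)%:E)%E by rewrite lee_fin.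
have := nneseries_lim_ge 1%N (fun n (_ : (0 <= n)%N) (_ : true) => wE0 n).
by rewrite big_nat1.
Qed.

Definition gibbs_prob n x := wt (e n) x / partition_fun x.

Lemma gibbs_prob_gt0 n x : 0 < gibbs_prob n x.
Proof. by rewrite divr_gt0 ?weight_gt0 ?partition_fun_gt0. Qed.

Lemma gibbs_prob_splice n w x : gibbs_prob n (splice w x) = gibbs_prob n x.
Proof.
have wE k : wt (e k) (splice w x) = wt (e k) x by exact: weight_splice.
have sE : (\sum_(k <oo) (wt (e k) (splice w x))%:E = \sum_(k <oo) (wt (e k) x)%:E)%E.
  by apply: eq_eseriesr => k _; rewrite wE.
by rewrite /gibbs_prob /partition_fun sE wE.
Qed.

Lemma measurable_gibbs_prob n : measurable_fun setT (gibbs_prob n).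
Proof.
apply: measurable_funM; first exact: measurable_weight.
apply: measurable_fun_inv_gt0; last exact: partition_fun_gt0.
apply: measurableT_comp => //; apply: ge0_emeasurable_sum => //.
  by move=> k x _ _; rewrite lee_fin.
by move=> k _; apply/measurable_EFinP; exact: measurable_weight.
Qed.

Lemma gibbs_prob_sum x : (\sum_(n <oo) (gibbs_prob n x)%:E = 1)%E.
Proof.
rewrite /gibbs_prob; under eq_eseriesr do rewrite mulrC EFinM.
rewrite nneseriesZl; last by move=> n _; rewrite lee_fin.
rewrite partition_funE -EFinM mulVf// gt_eqF//; exact: partition_fun_gt0.
Qed.

(** An error [d] in the exponents, uniform over patterns, changes every term by a factor between
    [expR (- d)] and [expR d], hence also the sum. In particular the sum is finite, so [fine] does
    not fall back on its default. *)
Let kernel_sum_near B x m (d : R) : (forall w : {ffun K -> nat},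
    `|energy E phi (splice w x) (splice base x)
      - energy_seq E phi (splice w x) (splice base x) m| <= d) ->
  expR (- d) * expR (birkhoff phi (E m) (splice base x)) * fine (wsum B x) <=
  fine (\esum_(w in [set: {ffun K -> nat}])
    (expR (birkhoff phi (E m) (splice w x)) * \1_B (splice w x))%:E) <=
  expR d * expR (birkhoff phi (E m) (splice base x)) * fine (wsum B x).
Proof.
move=> wd; set c := expR (birkhoff phi (E m) (splice base x)).
pose t w := (expR (birkhoff phi (E m) (splice w x)) * \1_B (splice w x))%:E.
have tw0 w : (0 <= t w)%E by rewrite lee_fin mulr_ge0// expR_ge0.
set S := (\sum_(n <oo) t (e n))%E.
rewrite (esum_e (a := t))// -/S.
have c0 : 0 < c by exact: expR_gt0.
have termE w : expR (birkhoff phi (E m) (splice w x)) =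
    c * expR (energy_seq E phi (splice w x) (splice base x) m).
  by rewrite -expRD /energy_seq addrC subrK.
have k0 (r : R) : 0 <= expR r * c by rewrite mulr_ge0// ?expR_ge0// ltW.
have scale (r : R) : ((expR r * c)%:E * wsum B x =
    \sum_(n <oo) (expR r * c * (wt (e n) x * \1_B (splice (e n) x)))%:E)%E.
  by rewrite -nneseriesZl// => n _; rewrite lee_fin mulr_ge0.
have ub : (S <= (expR d * c)%:E * wsum B x)%E.
  rewrite scale; apply: lee_nneseries => // n _; rewrite lee_fin mulrA.
  rewrite ler_wpM2r// termE [leRHS]mulrAC [leRHS]mulrC ler_pM2l// /weight -expRD ler_expR.
  by have := wd (e n); rewrite ler_distl => /andP[+ _]; lra.
have lb : ((expR (- d) * c)%:E * wsum B x <= S)%E.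
  rewrite scale; apply: lee_nneseries => [n _|n _]; first by rewrite lee_fin mulr_ge0// mulr_ge0.
  rewrite lee_fin mulrA ler_wpM2r// termE [leLHS]mulrAC [leLHS]mulrC ler_pM2l//.
  rewrite /weight -expRD ler_expR; have := wd (e n); rewrite ler_distl => /andP[_ +]; lra.
have S0 : (0 <= S)%E by exact: nneseries_ge0.
have Sfin : S \is a fin_num.
  rewrite ge0_fin_numE//; apply: le_lt_trans ub _.
  by rewrite -[wsum B x]fineK// -EFinM ltry.
by apply/andP; split; rewrite -lee_fin EFinM !fineK.
Qed.

Lemma gibbs_kernelE B x : (gibbs_kernel E phi K B x)%:E =
  (\sum_(n <oo) (gibbs_prob n x * \1_B (splice (e n) x))%:E)%E.
Proof.
have -> : (\sum_(n <oo) (gibbs_prob n x * \1_B (splice (e n) x))%:E)%E =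
    (fine (wsum B x) / partition_fun x)%:E.
  rewrite mulrC EFinM fineK// -nneseriesZl; last first.
    by move=> n _; rewrite lee_fin mulr_ge0.
  by apply: eq_eseriesr => n _; rewrite -EFinM mulrA [_^-1 * _]mulrC.
congr (_%:E); apply/cvg_lim => //; apply/cvgrPdist_le => r r0.
(* For this error in the exponents the bound of [ratio_near] is exactly [r]. *)
have d0 : 0 < ln (1 + r) / 2 by rewrite divr_gt0// ln_gt0// ltrDl.
have [m0 m0P] := energy_approx hE hvar K0 d0.
exists m0 => // m /= m0m.
have near_m B' := @kernel_sum_near B' x m _ (fun w => m0P m _ _ m0m (agree_off_splice w base x)).
apply: le_trans (ratio_near _ (partition_fun_gt0 x) _ (near_m B) _) _.
- apply/andP; split; first exact: fine_ge0.
  by rewrite /partition_fun -wsumT fine_le.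
- exact: expR_gt0.
- have := near_m setT; rewrite wsumT /=.
  by under eq_esum do rewrite indicT mulr1.
by rewrite -[_ *+ 2]mulr_natr divfK// lnK ?posrE ?addr_gt0// addrC addKr.
Qed.

Lemma gibbs_kernel_splice B w x :
  gibbs_kernel E phi K B (splice w x) = gibbs_kernel E phi K B x.
Proof.
apply: EFin_inj; rewrite (gibbs_kernelE B (splice w x)) (gibbs_kernelE B x).
apply: eq_eseriesr => n _.
by rewrite gibbs_prob_splice splice_splice.
Qed.

Lemma measurable_gibbs_kernel B : measurable B ->
  measurable_fun setT (gibbs_kernel E phi K B).
Proof.
move=> mB; apply/measurable_EFinP.
rewrite (_ : EFin \o _ = fun x =>
    (\sum_(n <oo) (gibbs_prob n x * \1_B (splice (e n) x))%:E)%E); last first.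
  by apply/funext => x; exact: gibbs_kernelE.
apply: ge0_emeasurable_sum => [n x _ _|n _].
  by rewrite lee_fin mulr_ge0// ltW// gibbs_prob_gt0.
apply/measurable_EFinP; apply: measurable_funM; first exact: measurable_gibbs_prob.
by apply: measurableT_comp => //; exact: measurable_splice hE _ _.
Qed.

Lemma gibbs_kernel_ge0 B x : 0 <= gibbs_kernel E phi K B x.
Proof.
rewrite -lee_fin gibbs_kernelE; apply: nneseries_ge0 => n _ _.
by rewrite lee_fin mulr_ge0// ltW// gibbs_prob_gt0.
Qed.

Lemma gibbs_kernel_le1 B x : gibbs_kernel E phi K B x <= 1.
Proof.
rewrite -lee_fin gibbs_kernelE -(gibbs_prob_sum x).
apply: lee_nneseries => n _; rewrite lee_fin.
  by rewrite mulr_ge0// ltW// gibbs_prob_gt0.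
rewrite ler_piMr ?indicE ?lern1 ?leq_b1//.
by apply/ltW/gibbs_prob_gt0.
Qed.

End GibbsKernel.

                                   

(** * Radon-Nikodym derivatives of image measures *)

Section RadonNikodymDistribution.
Context d (T : measurableType d) (R : realType) (mu : probability T R).
Local Open Scope ereal_scope.

Lemma Radon_Nikodym_distributionP (tau : {mfun T >-> T}) (f : T -> R) :
  measurable_fun setT f -> (forall x, 0 <= f x)%R ->
  {ae mu, forall x,
     Radon_Nikodym (charge_of_finite_measure (distribution mu tau)) mu x = (f x)%:E} <->
  (forall B, measurable B -> mu (tau @^-1` B) = \int[mu]_(x in B) (f x)%:E).
Proof.
move=> mf f0; set nu := charge_of_finite_measure _.
have mfe : measurable_fun setT (EFin \o f : T -> \bar R) by exact/measurable_EFinP.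
split=> [RNf B mB|nuf].
  have dom : nu `<< mu.
    (* Without domination [Radon_Nikodym] takes a default value that is never a real number. The
       assumed identity would then fail everywhere, making the whole space negligible. *)
    apply: contrapT => ndom; have : mu setT = 0.
      apply: (@measure_negligible _ _ _ mu) => //.
      move: RNf; apply: negligibleS => x _ /=.
      by rewrite /Radon_Nikodym; case: pselect.
    by rewrite probability_setT => /eqP; rewrite onee_eq0.
  etransitivity; first exact: (Radon_Nikodym_integral dom mB).
  apply: ae_eq_integral => //.
  - by apply: measurable_funTS; exact: measurable_int (Radon_Nikodym_integrable dom).
  - exact: measurable_funTS.
  - by apply: filterS RNf => x + _.
have dom : nu `<< mu.
  apply/null_content_dominatesP => A mA muA0.
  by rewrite -[LHS]/(mu (tau @^-1` A)) nuf// null_set_integral//; exact: measurable_funTS.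
have fi : mu.-integrable setT (EFin \o f).
  apply/integrableP; split => //.
  under eq_integral do rewrite /= ger0_norm//.
  by rewrite -nuf// preimage_setT probability_setT ltry.
have := @integral_ae_eq _ _ _ mu setT measurableT (EFin \o f)
  (Radon_Nikodym nu mu) (Radon_Nikodym_integrable dom).
move=> /(_ mfe); have H : forall B, B `<=` setT -> measurable B ->
    \int[mu]_(x in B) Radon_Nikodym nu mu x = \int[mu]_(x in B) (f x)%:E.
  by move=> B _ mB; rewrite -Radon_Nikodym_integral// -nuf.
by move=> /(_ H); apply: filterS => x; apply.
Qed.

End RadonNikodymDistribution.

(** Nonemptiness of [J] makes the set of functions infinite, so that its countability gives a
    bijection with all of nat. *)
Lemma ffun_nat_enumeration (J : finType) : (0 < #|J|)%N ->
  exists e : nat -> {ffun J -> nat}, set_bij setT setT e.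
Proof.
move=> /card_gt0P[i _].
have inf : infinite_set [set: {ffun J -> nat}].
  move=> fin; apply: infinite_nat.
  apply: (@sub_finite_set _ _ ((fun w : {ffun J -> nat} => w i) @` setT)).
    by move=> n _; exists [ffun=> n] => //; rewrite ffunE.
  exact: finite_image.
have /card_set_bijP[f [_ finj fsurj]] :=
  eq_card_nat (countableP [set: {ffun J -> nat}]) inf.
have /choice[e eK] n : exists w, f w = n by have [w _ <-] := fsurj n I; exists w.
exists e; split=> // [n m _ _ enm|w _]; first by rewrite -(eK n) enm.
by exists (f w) => //; apply: finj; rewrite ?in_setT.
Qed.

(** * The DLR and conformal conditions in one finite volume *)

Section FixedVolume.
Context (R : realType) (G : groupType).
Variables (E : nat -> {fset G}) (phi : config G -> R).
Hypotheses (hE : exhausting E) (hvar : summable_variation E phi).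
Hypothesis (hexp : exp_summable phi).
Variable mu : probability (config G) R.
Variables (K : {fset G}) (K0 : K != fset0).
Variables (e : nat -> {ffun K -> nat}) (e_bij : set_bij setT setT e).
Implicit Types (x : config G) (B : set (config G)).

Let C n := cylinder (e n).
Let S n : config G -> config G := splice (e n).
Let p := gibbs_prob E phi e.

Let C_disj n m x : C n x -> C m x -> n = m.
Proof.
move=> Cn Cm; case: e_bij => _ einj _; apply: einj; rewrite ?in_setT//.
by apply/ffunP => h; rewrite -Cn -Cm.
Qed.

Let C_cover : \bigcup_n C n = setT.
Proof.
apply/seteqP; split => // x _; case: e_bij => _ _ /(_ [ffun h => x (val h)] I)[n _ en].
by exists n => // h; rewrite en ffunE.
Qed.

Let C_triv : trivIset setT C.
Proof. by move=> n m _ _ [x [/C_disj]]; apply. Qed.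

Let mC n : measurable (C n). Proof. exact: measurable_cylinder. Qed.

Let mS n : measurable_fun setT (S n). Proof. exact: measurable_splice hE _ _. Qed.

Let S_id n x : C n x -> S n x = x. Proof. exact: splice_id. Qed.

Let S_comp n m x : S n (S m x) = S n x. Proof. exact: splice_splice. Qed.

Let mp n : measurable_fun setT (p n). Proof. exact: measurable_gibbs_prob. Qed.

Let p_gt0 n x : 0 < p n x. Proof. exact: gibbs_prob_gt0. Qed.

Let p_inv n m x : p n (S m x) = p n x. Proof. exact: gibbs_prob_splice. Qed.

Let p_sum x : (\sum_(n <oo) (p n x)%:E = 1)%E. Proof. exact: gibbs_prob_sum. Qed.

Lemma specification_conformal_volume :
  specification_eq mu C S p <-> conformal_eq mu C S p.
Proof.
split; first exact: specification_conformal.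
exact: conformal_specification.
Qed.

Let gibbs_kernel_C n x : gibbs_kernel E phi K (C n) x = p n x.
Proof.
apply: EFin_inj; rewrite (gibbs_kernelE hE hvar hexp K0 e_bij).
have CS m : \1_(C n) (splice (e m) x) = (m == n)%:R :> R.
  rewrite indicE; congr (nat_of_bool _)%:R; apply/idP/eqP => [|->].
    by rewrite inE; apply: C_disj; exact: splice_cylinder.
  by rewrite inE; exact: splice_cylinder.
rewrite (@nneseriesD1 _ _ n)//; last first.
  by move=> m _; rewrite lee_fin mulr_ge0// ltW.
rewrite CS eqxx mulr1 eseries0 ?adde0// => m _ /= mn.
by rewrite CS (negbTE mn) mulr0.
Qed.

Let coord_sigma_inv n A : coord_sigma (~` [set` K]) A -> S n @^-1` A = A.
Proof.
move=> cA; apply/seteqP; suff : [set A | forall x, A (S n x) <-> A x] A.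
  by move=> AS; split => x /AS.
move: A cA; apply: smallest_sub; last first.
  by move=> _ [g gK [V ->]] x /=; rewrite /S splice_out//; exact/negP.
split => // [A AS x|F FS x].
  by split=> -[_ nA]; split=> // /AS.
by split=> -[i _ /FS Fi]; exists i.
Qed.

(** Forwards, the DLR condition is tested on the cylinder [C n], whose kernel is [p n]. Backwards,
    the kernel itself is the required version: integrating its series over an event [A] off [K]
    gives the masses of [A] and [B] inside each [C n], which add up. *)
Lemma DLR_specification :
  (forall B, measurable B -> exists2 f : config G -> R,
     is_cond_prob mu (coord_sigma (~` [set` K])) B f &
     {ae mu, forall x, f x = gibbs_kernel E phi K B x}) <->
  specification_eq mu C S p.
Proof.
split=> [dlr n B mB|spec B mB].
  have [f [_ fi fE] fae] := dlr _ (mC n).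
  have cD : coord_sigma (~` [set` K]) (S n @^-1` B).
    by exact: (@coord_sigma_splice G E hE K (e n) B).
  have mD := coord_sigma_measurable cD.
  rewrite setIC; etransitivity; first exact: (esym (fE _ cD)).
  apply: ae_eq_integral => //.
  - by apply: measurable_funTS; exact: measurable_int fi.
  - by apply: measurable_funTS; exact/measurable_EFinP.
  - by apply: filterS fae => x fx _; rewrite /= fx gibbs_kernel_C.
exists (gibbs_kernel E phi K B); last by apply: aeW.
have mg := measurable_gibbs_kernel hE hvar hexp K0 e_bij mB.
split.
- move=> V mV.
  (* The kernel is unchanged by splicing, so its preimages are preimages under [S 0], which are
     events off [K]. *)
  rewrite (_ : _ @^-1` V = S 0%N @^-1` (gibbs_kernel E phi K B @^-1` V)).
    apply: (@coord_sigma_splice G E hE K (e 0%N)).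
    by rewrite -[X in measurable X]setTI; exact: mg.
  by apply/seteqP; split => x /=; rewrite (gibbs_kernel_splice hE hvar hexp K0 e_bij).
- apply: (@le_integrable _ _ _ mu setT measurableT _ (cst 1%:E)).
  + exact/measurable_EFinP.
  + move=> x _; rewrite /= normr1 lee_fin ger0_norm.
      exact: (gibbs_kernel_le1 hE hvar hexp K0 e_bij).
    exact: (gibbs_kernel_ge0 hE hvar hexp K0 e_bij).
  + exact: finite_measure_integrable_cst.
move=> A cA; have mA := coord_sigma_measurable cA.
have mSpre n : measurable (S n @^-1` B).
  by rewrite -[X in measurable X]setTI; exact: mS.
under eq_integral do rewrite (gibbs_kernelE hE hvar hexp K0 e_bij).
rewrite integral_nneseries//; last 2 first.
- move=> n; apply: measurable_funTS; apply/measurable_EFinP.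
  by apply: measurable_funM => //; apply: measurableT_comp => //; exact: mS.
- by move=> n x _; rewrite lee_fin mulr_ge0// ltW.
transitivity (\sum_(n <oo) mu (C n `&` (A `&` B)))%E.
  apply: eq_eseriesr => n _.
  have mAB : measurable (A `&` B) by exact: measurableI.
  have -> : C n `&` (A `&` B) = C n `&` S n @^-1` (A `&` B).
    by apply/seteqP; split => x [Cx /=]; rewrite S_id.
  rewrite spec// preimage_setI coord_sigma_inv// integral_mkcondr.
  apply: eq_integral => x _; rewrite patchE indicE.
  have -> : (splice (e n) x \in B) = (x \in S n @^-1` B).
    by apply/idP/idP; rewrite !inE.
  by case: ifPn => _; rewrite ?mulr1 ?mulr0.
rewrite (@eq_eseriesl _ _ (fun n => n \in [set: nat])); last first.
  by move=> n; rewrite in_setT.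
rewrite -measure_bigcup//.
- by rewrite -setI_bigcupl C_cover setTI.
- by move=> n _; apply: measurableI => //; exact: measurableI.
- by apply: trivIset_setIr.
Qed.

(** The partition function cancels and additivity of [energy] removes the zero pattern; on [C m] the
    point x is its own splice by [e m]. *)
Let p_ratio n m x : C m x -> p n x / p m x = expR (energy E phi (S n x) x).
Proof.
move=> Cm; have z0 := gt_eqF (partition_fun_gt0 hE hvar hexp K0 e_bij x).
rewrite /p /gibbs_prob invf_div mulrA divfK ?z0//.
have agS (v w : {ffun K -> nat}) : agree_off K (splice v x) (splice w x).
  exact: agree_off_splice.
have agx (v : {ffun K -> nat}) : agree_off K x (splice v x).
  by rewrite -{1}(S_id Cm); exact: agS.
have agn : agree_off K (S n x) x by rewrite -{2}(S_id Cm); exact: agS.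
rewrite /weight -expRN -expRD; congr expR.
by rewrite (splice_id Cm) (energyD hE hvar K0 agn (agx _)) addrK.
Qed.

(** A local permutation acts on [K] symbol by symbol, so it sends the pattern [e n] to a single
    pattern [e m] whatever stands outside. *)
Let splice_image (tau taui : config G -> config G) A n :
  local_perm K A tau -> cancel tau taui -> cancel taui tau ->
  exists m, [/\ taui @^-1` C n = C m, forall x, C n x -> tau x = S m x &
                forall x, C m x -> taui x = S n x].
Proof.
move=> [t [tbij _ tauE]] tauK tauiK.
case: e_bij => _ _ /(_ [ffun h => t (val h) (e n h)] I)[m _ em].
have CE x : C n x <-> C m (tau x).
  split=> [Cx h|Cx h]; last have := Cx h; rewrite em ffunE tauE (valP h).
    by rewrite Cx.
  by move/(bij_inj (tbij (val h))).
have tauS x : C n x -> tau x = S m x.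
  move=> Cx; apply/funext => g; have [gK|gK] := boolP (g \in K).
    by rewrite -[g]/(val [` gK]%fset) /S splice_in -(proj1 (CE x) Cx).
  by rewrite /S splice_out// tauE (negbTE gK).
exists m; split => //.
  by apply/seteqP; split => x /=; [move/CE|move=> Cx; apply/CE]; rewrite tauiK.
move=> x Cx; have Cy : C n (taui x) by apply/CE; rewrite tauiK.
by rewrite -{2}(tauiK x) (tauS _ Cy) S_comp S_id.
Qed.

Let local_perm_inv_agree (tau taui : config G -> config G) A x :
  local_perm K A tau -> cancel taui tau -> agree_off K (taui x) x.
Proof.
by move=> [t [_ _ tauE]] tauiK g gK; rewrite -{2}(tauiK x) tauE (negbTE gK).
Qed.

Let local_perm_inv_measurable (tau taui : config G -> config G) A :
  local_perm K A tau -> cancel taui tau -> measurable_fun setT taui.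
Proof.
move=> [t [tbij _ tauE]] tauiK _ B mB; rewrite setTI.
apply: (@coord_sigma_measurable _ setT).
apply: (coord_sigma_preimage hE) => // g V.
apply: (@coord_sigmaS _ [set` [fset g]%fset]) => //.
apply: coord_sigma_local => x y xy /=.
have {}xy : x g = y g by apply: xy; rewrite inE.
suff -> : taui x g = taui y g by [].
have := tauE (taui x) g; have := tauE (taui y) g; rewrite !tauiK -xy => ->.
by case: ifP => // _ /(bij_inj (tbij g)).
Qed.

Let measurable_cocycle (tau taui : config G -> config G) A :
  local_perm K A tau -> cancel taui tau ->
  measurable_fun setT (fun x => expR (cocycle E phi taui x)).
Proof.
move=> tauP tauiK; apply: measurableT_comp => //.
apply: (measurable_energy hE hvar K0 _ (local_perm_inv_measurable tauP tauiK)).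
  by move=> x; exact: local_perm_inv_agree tauP tauiK.
exact: measurable_id.
Qed.

(** A given local permutation is cut along the cylinders, on each of which it is a splice map with
    density given by [p_ratio]. Conversely [conformal_eq] for [n] and [m] comes from one involution,
    which exchanges [C n] and [C m]. *)
Lemma conformal_volume :
  (forall A : {fset nat}, A != fset0 ->
   forall (tau : {mfun config G >-> config G}) (taui : config G -> config G),
     local_perm K A tau -> cancel tau taui -> cancel taui tau ->
     {ae mu, forall x,
       Radon_Nikodym (charge_of_finite_measure (distribution mu tau)) mu x =
       (expR (cocycle E phi taui x))%:E}) <->
  conformal_eq mu C S p.
Proof.
split=> [conf n m B mB|conf A A0 tau taui tauP tauK tauiK]; last first.
  apply/Radon_Nikodym_distributionP => [| |B mB].
  - exact: measurable_cocycle tauP tauiK.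
  - by move=> x; exact: expR_ge0.
  have mtau B' : measurable B' -> measurable (tau @^-1` B').
    by move=> mB'; rewrite -[X in measurable X]setTI; exact: measurable_funPT.
  have mtaui := local_perm_inv_measurable tauP tauiK.
  transitivity (\sum_(n <oo) mu (C n `&` tau @^-1` B))%E.
    rewrite (@eq_eseriesl _ _ (fun n => n \in [set: nat])); last first.
      by move=> n; rewrite in_setT.
    rewrite -measure_bigcup//.
    - by rewrite -setI_bigcupl C_cover setTI.
    - by move=> n _; apply: measurableI => //; exact: mtau.
    - exact: trivIset_setIr.
  transitivity (\sum_(n <oo) \int[mu]_(x in taui @^-1` C n `&` B)
      (expR (cocycle E phi taui x))%:E)%E.
    apply: eq_eseriesr => n _.
    have [m [-> tauS tauiS]] := splice_image n tauP tauK tauiK.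
    have -> : C n `&` tau @^-1` B = C n `&` S m @^-1` B.
      by apply/seteqP; split => x [Cx /=]; rewrite (tauS _ Cx).
    rewrite conf//; apply: eq_integral => x; rewrite inE => -[Cx _].
    by rewrite p_ratio// -tauiS.
  have tauiC : (\bigcup_n (taui @^-1` C n `&` B))%classic = B.
    by rewrite -setI_bigcupl -preimage_bigcup C_cover preimage_setT setTI.
  rewrite -ge0_integral_bigcup//.
  - by rewrite tauiC.
  - move=> n; apply: measurableI => //.
    by rewrite -[X in measurable X]setTI; exact: mtaui.
  - by apply: measurable_funTS; apply/measurable_EFinP; exact: measurable_cocycle tauP tauiK.
  - by move=> i j _ _ [x [[Ci _] [Cj _]]]; exact: C_disj Ci Cj.
(* At each site h of [K] the involution transposes the symbols [e n h] and [e m h]; the set [A]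
   below collects these finitely many symbols. *)
pose sw (a b c : nat) := if c == a then b else if c == b then a else c.
have swK a b : involutive (sw a b).
  move=> c; rewrite /sw; have [->|ca] := eqVneq c a.
    by have [->|ba] := eqVneq b a; rewrite ?eqxx.
  by have [->|cb] := eqVneq c b; rewrite ?eqxx// (negbTE ca) (negbTE cb).
pose t (g : G) : nat -> nat :=
  oapp (fun h : K => sw (e n h) (e m h)) id (insub g).
have tE (h : K) : t (val h) = sw (e n h) (e m h) by rewrite /t valK.
have tK g : involutive (t g) by rewrite /t; case: insubP => [h _ _|_]//=.
pose A := ([fset e n h | h : K] `|` [fset e m h | h : K])%fset.
have inA (h : K) : (e n h \in A) && (e m h \in A).
  by rewrite !in_fsetU !in_imfset ?orbT.
have A0 : A != fset0.
  case/fset0Pn : (K0) => g gK; apply/fset0Pn; exists (e n [` gK]%fset).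
  by case/andP: (inA [` gK]%fset).
pose tau (x : config G) : config G := fun g => if g \in K then t g (x g) else x g.
have tauP : local_perm K A tau.
  exists t; split => // [g|g a aA]; first exact: inv_bij.
  rewrite /t; case: insubP => [h _ _|_]//=; have /andP[nA mA] := inA h.
  rewrite /sw; case: eqP => [an|_]; first by rewrite an nA in aA.
  by case: eqP => // am; rewrite am mA in aA.
have tauK : involutive tau.
  by move=> x; apply/funext => g; rewrite /tau; have [_|//] := boolP (g \in K); exact: tK.
have mtau : tau \in mfun by rewrite inE; exact: local_perm_measurable tauP.
have := @Radon_Nikodym_distributionP _ _ _ mu (mfun_Sub mtau)
  (fun x => expR (cocycle E phi tau x)) (measurable_cocycle tauP tauK)
  (fun x => expR_ge0 _).
move=> [/(_ (conf A A0 (mfun_Sub mtau) tau tauP tauK tauK)) + _].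
move=> /(_ _ (measurableI _ _ (mC m) mB)) tau_int.
have tauS x : C n x -> tau x = S m x.
  move=> Cx; apply/funext => g; have [gK|gK] := boolP (g \in K).
    rewrite -[g]/(val [` gK]%fset) /S splice_in /tau (valP [` gK]%fset) tE Cx.
    by rewrite /sw eqxx.
  by rewrite /S splice_out// /tau (negbTE gK).
have tauS' x : C m x -> tau x = S n x.
  move=> Cx; apply/funext => g; have [gK|gK] := boolP (g \in K).
    rewrite -[g]/(val [` gK]%fset) /S splice_in /tau (valP [` gK]%fset) tE Cx.
    by rewrite /sw; case: eqP => // _; rewrite eqxx.
  by rewrite /S splice_out// /tau (negbTE gK).
(* Testing on [C m] makes only [C n] contribute to the preimage, and there [tau] is [S m]. *)
have <- : tau @^-1` (C m `&` B) = C n `&` S m @^-1` B.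
  apply/seteqP; split => x /= [Cx].
    have CSx : C n x by rewrite -(tauK x) (tauS' _ Cx); exact: splice_cylinder.
    by rewrite (tauS _ CSx).
  by rewrite (tauS _ Cx); split => //; exact: splice_cylinder.
rewrite [LHS]tau_int; apply: eq_integral => x; rewrite inE => -[Cx _].
by rewrite p_ratio// -tauS'.
Qed.

End FixedVolume.

Theorem theorem5p6 (R : realType) (G : groupType)
    (hcount : countable [set: G]) (hamen : amenable R G)
    (E : nat -> {fset G}) (hE : exhausting E)
    (phi : config G -> R)
    (hexp : exp_summable phi) (hvar : summable_variation E phi)
    (mu : probability (config G) R) :
  is_DLR E phi mu <-> is_conformal E phi mu.
Proof.
have volume (K : {fset G}) : K != fset0 ->
    exists e : nat -> {ffun K -> nat}, set_bij setT setT e.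
  move=> /fset0Pn[g gK]; apply: ffun_nat_enumeration.
  by apply/card_gt0P; exists [` gK]%fset.
split=> [dlr|conf] K.
- move=> A K0 A0; have [e e_bij] := volume K K0.
  apply: (proj2 (conformal_volume hE hvar hexp mu K0 e_bij)) => //.
  apply/(specification_conformal_volume hE hvar hexp mu K0 e_bij).
  by apply/(DLR_specification hE hvar hexp mu K0 e_bij); exact: dlr.
- move=> K0; have [e e_bij] := volume K K0.
  apply/(DLR_specification hE hvar hexp mu K0 e_bij).
  apply/(specification_conformal_volume hE hvar hexp mu K0 e_bij).
  apply/(conformal_volume hE hvar hexp mu K0 e_bij) => A A0.
  exact: conf.
Qed.
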